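(* ADOM with multi-consensus (the specific dual-oracle method written out in the context) requires $$\mathcal O\left(\sqrt{L/\mu}\,\log\frac1\epsilon\right)\ \text{local computation rounds and}\quad \mathcal O\left(\chi\sqrt{L/\mu}\,\log\frac1\epsilon\right)\ \text{decentralized communication rounds}$$ to find an $\epsilon$-accurate solution of the distributed optimization problem $\min_{x\in\mathbb R^d}\sum_{i=1}^nf_i(x)$.
   Context: **Problem.** $\mathcal V=\{1,\dots,n\}$; the functions $f_i:\mathbb R^d\to\mathbb R$, stored at node $i$, are $L$-smooth and $\mu$-strongly convex, $0<\mu\le L$, i.e. $f_i(y)+\langle\nabla f_i(y),x-y\rangle+\frac\mu2\|x-y\|^2\le f_i(x)\le f_i(y)+\langle\nabla f_i(y),x-y\rangle+\frac L2\|x-y\|^2$ for all $x,y\in\mathbb R^d$. $f_i^*(x)=\sup_{y\in\mathbb R^d}[\langle x,y\rangle-f_i(y)]$ is the Fenchel conjugate. Dual oracle: node $i$ can evaluate $\nabla f_i^*$. For $z=(z_1,\dots,z_n)\in(\mathbb R^d)^{\mathcal V}$ put $F^*(z)=\sum_{i}f_i^*(z_i)$, so $\nabla F^*(z)=(\nabla f_1^*(z_1),\dots,\nabla f_n^*(z_n))$. Let $\mathcal L^\perp=\{z\in(\mathbb R^d)^{\mathcal V}:\sum_iz_i=0\}$. **Network with condition number $\chi$.** For communication rounds $q=0,1,2,\dots$ there are graphs $\mathcal G^q=(\mathcal V,\mathcal E^q)$, $\mathcal E^q\subset\{(i,j)\in\mathcal V\times\mathcal V:i\ne j\}$, and in round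 $q$ node $i$ can communicate only with the nodes $j$ such that $(i,j)\in\mathcal E^q$. There are gossip matrices $\mathbf W(q)\in\mathbb R^{n\times n}$ with: $\mathbf W(q)_{i,j}\ne0$ iff $(i,j)\in\mathcal E^q$ or $i=j$; $\ker\mathbf W(q)\supset\{x\in\mathbb R^n:x_1=\dots=x_n\}$; $\mathrm{range}\,\mathbf W(q)\subset\{x\in\mathbb R^n:\sum_ix_i=0\}$; and there is $\chi\ge1$, common to all $q$, with $\|\mathbf W(q)x-x\|^2\le(1-\chi^{-1})\|x\|^2$ whenever $\sum_ix_i=0$. The matrices need not be symmetric. One decentralized communication round (number $q$) is a multiplication of stacked vectors by $\mathbf W(q)\otimes\mathbf I_d$, where $\mathbf I_d$ is the $d\times d$ identity and $\otimes$ the Kronecker product. **Multi-consensus.** Let $T=\lceil\chi\ln2\rceil$ and $\mathbf W(k;T)=\mathbf I-\prod_{q=kT}^{(k+1)T-1}(\mathbf I-\mathbf W(q))$. Multiplying by $\mathbf W(k;T)\otimes\mathbf I_d$ costs $T$ communication rounds, and $\|(\mathbf W(k;T)\otimes\mathbf I_d)x-x\|^2\le\frac12\|x\|^2$ for $x\in\mathcal L^\perp$. **ADOM with multi-consensus.** This is the method ADOM of Kovalev et al. (2021) in which the gossip matrix used in iteration $k$ is replaced by $\mathbf W(k;T)$. Choose $z^0\in\mathcal L^\perp$, $m^0\in(\mathbb R^d)^{\mathcal V}$, set $z_f^0=z^0$, and for $k=0,1,2,\dots$ iterate $$\begin{aligned} z_g^k&=\tau z^k+(1-\tau)z_f^k,\\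 \Delta^k&=\sigma(\mathbf W(k;T)\otimes\mathbf I_d)\bigl(m^k-\eta\nabla F^*(z_g^k)\bigr),\\ m^{k+1}&=m^k-\eta\nabla F^*(z_g^k)-\Delta^k,\\ z^{k+1}&=z^k+\eta\alpha(z_g^k-z^k)+\Delta^k,\\ z_f^{k+1}&=z_g^k-\theta(\mathbf W(k;T)\otimes\mathbf I_d)\nabla F^*(z_g^k), \end{aligned}$$ with parameters $\alpha=\frac1{2L}$, $\eta=\frac{2\sqrt{\mu L}}{7\hat\chi}$, $\theta=\mu$, $\sigma=1$, $\tau=\frac1{7\hat\chi}\sqrt{\mu/L}$, where $\hat\chi=2$ is the condition number of the matrices $\mathbf W(k;T)$. Each iteration performs $\mathcal O(1)$ local computation rounds (one evaluation of $\nabla f_i^*$ at each node $i$) and $\mathcal O(T)=\mathcal O(\chi)$ decentralized communication rounds. **Accuracy and asymptotic notation.** The output after iteration $k$ is $x^k=\nabla F^*(z_g^k)\in(\mathbb R^d)^{\mathcal V}$, whose $i$-th block is held by node $i$. It is an $\epsilon$-accurate solution if $\|x^k-x^*\|^2\le\epsilon$, where every block of $x^*\in(\mathbb R^d)^{\mathcal V}$ equals the unique minimizer of $\sum_if_i$. $\mathcal O(\cdot)$ hides a universal constant, for $\epsilon>0$ below a threshold that may depend on the problem and the initial point. *)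

(* Defs.v *)
(* MathComp / MathComp-Analysis, over an arbitrary R : realType.
   R^d is 'rV[R]_d.  A stacked vector z = (z_1, ..., z_n) of (R^d)^n is an
   n x d matrix whose i-th row is z_i. *)
From HB Require Import structures.
From mathcomp Require Import all_boot all_order all_algebra.
From mathcomp Require Import all_classical all_reals all_analysis.
Set Implicit Arguments.
Unset Strict Implicit.
Unset Printing Implicit Defensive.
Import Order.TTheory GRing.Theory Num.Theory numFieldNormedType.Exports.
Local Open Scope classical_set_scope.
Local Open Scope ring_scope.

(* The norm `|x| that the library puts on matrices is the sup norm, so the
   Euclidean structure is defined here. *)
Definition inner (R : realType) (m n : nat) (x y : 'M[R]_(m, n)) : R :=
  \sum_i \sum_j x i j * y i j.

Definition normsq (R : realType) (m n : nat) (x : 'M[R]_(m, n)) : R :=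
  inner x x.

(* Vector of partial derivatives; used both on R^d (m = 1) and on stacked
   vectors. *)
Definition grad (R : realType) (m n : nat) (f : 'M[R]_(m, n) -> R)
    (x : 'M[R]_(m, n)) : 'M[R]_(m, n) :=
  \matrix_(i, j) 'D_(delta_mx i j) f x.

Definition smooth_strongly_convex (R : realType) (d : nat) (mu L : R)
    (f : 'rV[R]_d -> R) : Prop :=
  (forall x, differentiable f x) /\
  (forall x y,
     f y + inner (grad f y) (x - y) + mu / 2 * normsq (x - y) <= f x /\
     f x <= f y + inner (grad f y) (x - y) + L / 2 * normsq (x - y)).

(* The real-valued [sup] is the true supremum when f is strongly convex: the
   set is then nonempty and bounded above. *)
Definition fenchel (R : realType) (d : nat) (f : 'rV[R]_d -> R)
    (x : 'rV[R]_d) : R :=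
  sup [set inner x y - f y | y in [set: 'rV[R]_d]].

Definition Fstar (R : realType) (n d : nat) (f : 'I_n -> 'rV[R]_d -> R)
    (z : 'M[R]_(n, d)) : R :=
  \sum_(i < n) fenchel (f i) (row i z).

Definition in_Lperp (R : realType) (n d : nat) (z : 'M[R]_(n, d)) : Prop :=
  \sum_(i < n) row i z = 0.

Record gossip_matrix (R : realType) (n : nat) (chi : R)
    (E : {set 'I_n * 'I_n}) (W : 'M[R]_n) : Prop := GossipMatrix {
  gossip_support : forall i j, W i j != 0 <-> (i, j) \in E \/ i = j;
  gossip_ker : forall x : 'cV[R]_n,
    (forall i j, x i 0 = x j 0) -> W *m x = 0;
  gossip_range : forall x : 'cV[R]_n, \sum_(i < n) (W *m x) i 0 = 0;
  gossip_contraction : forall x : 'cV[R]_n, \sum_(i < n) x i 0 = 0 ->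
    normsq (W *m x - x) <= (1 - chi^-1) * normsq x
}.

Record gossip_network (R : realType) (n : nat) (chi : R)
    (E : nat -> {set 'I_n * 'I_n}) (W : nat -> 'M[R]_n) : Prop :=
  GossipNetwork {
  network_no_loop : forall q i, (i, i) \notin E q;
  network_chi_ge1 : 1 <= chi;
  network_gossip : forall q, gossip_matrix chi (E q) (W q)
}.

Definition consensus_rounds (R : realType) (chi : R) : nat :=
  `|Num.ceil (chi * ln 2)|%N.

(* W(k;T).  The factors do not commute in general; they are ordered so that
   round q = kT acts first (rightmost factor) and round q = (k+1)T-1 last,
   which is what T successive communication rounds compute. *)
Definition multi_consensus (R : realType) (n : nat) (W : nat -> 'M[R]_n)
    (T k : nat) : 'M[R]_n :=
  1%:M - \big[mulmx/1%:M]_(q <- rev (index_iota (k * T)%N (k.+1 * T)%N))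
           (1%:M - W q).

Record adom_params (R : realType) := AdomParams {
  p_alpha : R; p_eta : R; p_theta : R; p_sigma : R; p_tau : R
}.

Record adom_state (R : realType) (n d : nat) := AdomState {
  st_z : 'M[R]_(n, d); st_zf : 'M[R]_(n, d); st_m : 'M[R]_(n, d)
}.

Definition adom_zg (R : realType) (n d : nat) (p : adom_params R)
    (s : adom_state R n d) : 'M[R]_(n, d) :=
  p_tau p *: st_z s + (1 - p_tau p) *: st_zf s.

(* (Wk \otimes I_d) z has i-th block \sum_j Wk i j *: z_j: on stacked vectors
   encoded as n x d matrices this is Wk *m z. *)
Definition adom_step (R : realType) (n d : nat) (p : adom_params R)
    (gradF : 'M[R]_(n, d) -> 'M[R]_(n, d)) (Wk : 'M[R]_n)
    (s : adom_state R n d) : adom_state R n d :=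
  let zg := adom_zg p s in
  let g := gradF zg in
  let Delta := p_sigma p *: (Wk *m (st_m s - p_eta p *: g)) in
  AdomState
    (st_z s + (p_eta p * p_alpha p) *: (zg - st_z s) + Delta)
    (zg - p_theta p *: (Wk *m g))
    (st_m s - p_eta p *: g - Delta).

Fixpoint adom_run (R : realType) (n d : nat) (p : adom_params R)
    (gradF : 'M[R]_(n, d) -> 'M[R]_(n, d)) (Ws : nat -> 'M[R]_n)
    (z0 m0 : 'M[R]_(n, d)) (k : nat) : adom_state R n d :=
  match k with
  | 0%N => AdomState z0 z0 m0
  | k'.+1 => adom_step p gradF (Ws k') (adom_run p gradF Ws z0 m0 k')
  end.

Definition adom_mc_params (R : realType) (mu L : R) : adom_params R :=
  let hat_chi : R := 2 in
  {| p_alpha := 1 / (2 * L);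
     p_eta := 2 * Num.sqrt (mu * L) / (7 * hat_chi);
     p_theta := mu;
     p_sigma := 1;
     p_tau := 1 / (7 * hat_chi) * Num.sqrt (mu / L) |}.

(* x^k = grad F^*(z_g^k) *)
Definition adom_mc_output (R : realType) (n d : nat) (mu L chi : R)
    (f : 'I_n -> 'rV[R]_d -> R) (W : nat -> 'M[R]_n)
    (z0 m0 : 'M[R]_(n, d)) (k : nat) : 'M[R]_(n, d) :=
  let p := adom_mc_params mu L in
  let gradF := grad (Fstar f) in
  let Ws := multi_consensus W (consensus_rounds chi) in
  gradF (adom_zg p (adom_run p gradF Ws z0 m0 k)).

(* Cost of iterations 0, ..., k: each one evaluates grad F^* once, at z_g. *)
Definition adom_mc_local_rounds (k : nat) : nat := k.+1.

(* Iteration k' uses the communication rounds q = k'T, ..., (k'+1)T-1 (both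
   products with W(k';T) share these rounds), so iterations 0, ..., k use the
   rounds q < (k+1)T. *)
Definition adom_mc_comm_rounds (R : realType) (chi : R) (k : nat) : nat :=
  (k.+1 * consensus_rounds chi)%N.

Definition unique_minimizer (R : realType) (d : nat) (F : 'rV[R]_d -> R)
    (x : 'rV[R]_d) : Prop :=
  forall y, y != x -> F x < F y.

(* The existence of the minimizer is part of this predicate. *)
Definition eps_accurate (R : realType) (n d : nat)
    (f : 'I_n -> 'rV[R]_d -> R) (eps : R) (x : 'M[R]_(n, d)) : Prop :=
  exists xstar : 'rV[R]_d,
    unique_minimizer (fun y => \sum_(i < n) f i y) xstar /\
    normsq (x - \matrix_(i < n) xstar) <= eps.

(* Main.v *)
(* Fstar is 1/L-strongly convex and 1/mu-smooth, and z_opt = (grad f_i(x_opt))_i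
   lies in L^perp with grad Fstar(z_opt) = x_opt in every block.  Let P be the
   orthogonal projection onto L^perp.  Since W(k;T) vanishes on consensus vectors
   and has range in L^perp, z + P m is incremented by
     tau (z_g - z) - eta P grad Fstar(z_g),
   as in an accelerated gradient method with exact projections, while P m itself
   contracts up to a multiple of eta P grad Fstar(z_g).  The step to z_f decreases
   Fstar by mu/4 |P grad Fstar(z_g)|^2, which pays for that multiple, so
     |z + P m - z_opt|^2 + |P m|^2 + 4 L (Fstar(z_f) - Fstar(z_opt))
   decreases by the factor 1 - tau/14 per iteration, with a surplus proportional to
   |z_g - z_opt|^2.  No symmetry of the gossip matrices is needed:
   |W x - x|^2 <= |x|^2 / 2 gives both the descent and the contraction. *)

Require Import Defs.
From HB Require Import structures.
From mathcomp Require Import all_boot all_order all_algebra.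
From mathcomp Require Import all_classical all_reals all_analysis.
From mathcomp Require Import ring lra.
Set Implicit Arguments.
Unset Strict Implicit.
Unset Printing Implicit Defensive.
Import Order.TTheory GRing.Theory Num.Theory numFieldNormedType.Exports.
Local Open Scope ring_scope.

(** * Euclidean structure and quadratically bounded functions *)

Lemma inner_tr (R : realType) (m n : nat) (x y : 'M[R]_(m, n)) :
  inner x y = \tr (x *m y^T).
Proof.
rewrite /inner /mxtrace; apply: eq_bigr => i _; rewrite mxE.
by apply: eq_bigr => j _; rewrite mxE.
Qed.

Lemma innerC (R : realType) (m n : nat) (x y : 'M[R]_(m, n)) :
  inner x y = inner y x.
Proof. by rewrite !inner_tr -[LHS]mxtrace_tr trmx_mul trmxK. Qed.

Lemma innerDl (R : realType) (m n : nat) (x y z : 'M[R]_(m, n)) :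
  inner (x + y) z = inner x z + inner y z.
Proof. by rewrite !inner_tr mulmxDl raddfD. Qed.

Lemma innerNl (R : realType) (m n : nat) (x z : 'M[R]_(m, n)) :
  inner (- x) z = - inner x z.
Proof. by rewrite !inner_tr mulNmx raddfN. Qed.

Lemma innerZl (R : realType) (m n : nat) (a : R) (x z : 'M[R]_(m, n)) :
  inner (a *: x) z = a * inner x z.
Proof. by rewrite !inner_tr -scalemxAl mxtraceZ. Qed.

Lemma innerDr (R : realType) (m n : nat) (x y z : 'M[R]_(m, n)) :
  inner z (x + y) = inner z x + inner z y.
Proof. by rewrite innerC innerDl !(innerC z). Qed.

Lemma innerNr (R : realType) (m n : nat) (x z : 'M[R]_(m, n)) :
  inner z (- x) = - inner z x.
Proof. by rewrite innerC innerNl innerC. Qed.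

Lemma innerZr (R : realType) (m n : nat) (a : R) (x z : 'M[R]_(m, n)) :
  inner z (a *: x) = a * inner z x.
Proof. by rewrite innerC innerZl innerC. Qed.

Definition innerE := (innerDl, innerDr, innerNl, innerNr, innerZl, innerZr).

Lemma inner0r (R : realType) (m n : nat) (x : 'M[R]_(m, n)) : inner x 0 = 0.
Proof. by rewrite -(scale0r 0) innerZr mul0r. Qed.

Lemma inner_mulmxl (R : realType) (m n p : nat) (A : 'M[R]_(m, p))
    (x : 'M[R]_(p, n)) (y : 'M[R]_(m, n)) :
  inner (A *m x) y = inner x (A^T *m y).
Proof.
by rewrite !inner_tr mxtrace_mulC trmx_mul trmxK mulmxA mxtrace_mulC.
Qed.

Lemma inner_row (R : realType) (m n : nat) (x y : 'M[R]_(m, n)) :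
  inner x y = \sum_i inner (row i x) (row i y).
Proof.
apply: eq_bigr => i _; rewrite /inner big_ord1.
by apply: eq_bigr => j _; rewrite !mxE.
Qed.

Lemma inner_sumr (R : realType) (m n : nat) (I : finType)
    (x : 'M[R]_(m, n)) (y : I -> 'M[R]_(m, n)) :
  inner x (\sum_i y i) = \sum_i inner x (y i).
Proof.
by apply: (big_morph (inner x)) => [u v|]; rewrite ?innerDr ?inner0r.
Qed.

Lemma normsq_ge0 (R : realType) (m n : nat) (x : 'M[R]_(m, n)) :
  0 <= normsq x.
Proof. by apply: sumr_ge0 => i _; apply: sumr_ge0 => j _; rewrite -expr2 sqr_ge0. Qed.

Lemma sqr_entry_le_normsq (R : realType) (m n : nat) (x : 'M[R]_(m, n)) i j :
  x i j ^+ 2 <= normsq x.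
Proof.
rewrite /normsq /inner (bigD1 i) //= (bigD1 j) //= -expr2 -addrA lerDl.
apply: addr_ge0; apply: sumr_ge0 => k _; first by rewrite -expr2 sqr_ge0.
by apply: sumr_ge0 => l _; rewrite -expr2 sqr_ge0.
Qed.

Lemma normsq_gt0 (R : realType) (m n : nat) (x : 'M[R]_(m, n)) :
  x != 0 -> 0 < normsq x.
Proof.
move=> x0; rewrite lt_neqAle normsq_ge0 andbT; apply: contra x0 => /eqP x0.
apply/eqP/matrixP => i j; rewrite mxE; apply/eqP.
by rewrite -sqrf_eq0 eq_le sqr_ge0 andbT x0 sqr_entry_le_normsq.
Qed.

Lemma normsqC (R : realType) (m n : nat) (x y : 'M[R]_(m, n)) :
  normsq (x - y) = normsq (y - x).
Proof. by rewrite -(opprB y x) /normsq innerNl innerNr opprK. Qed.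

(** [G] plays the gradient but is kept abstract, so stacks, sums and conjugates carry the bounds
    with an explicit [G]. *)
Definition quad_bounds (R : realType) (m n : nat) (mu L : R)
    (f : 'M[R]_(m, n) -> R) (G : 'M[R]_(m, n) -> 'M[R]_(m, n)) : Prop :=
  forall x y,
    f y + inner (G y) (x - y) + mu / 2 * normsq (x - y) <= f x /\
    f x <= f y + inner (G y) (x - y) + L / 2 * normsq (x - y).

Lemma quad_bounds_stack (R : realType) (n d : nat) (mu L : R)
    (f : 'I_n -> 'rV[R]_d -> R) (G : 'I_n -> 'rV[R]_d -> 'rV[R]_d) :
  (forall i, quad_bounds mu L (f i) (G i)) ->
  quad_bounds mu L (fun z : 'M[R]_(n, d) => \sum_i f i (row i z))
    (fun z => \matrix_i G i (row i z)).
Proof.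
move=> fG x y; rewrite /normsq !(inner_row _ (x - y)) !mulr_sumr -!big_split /=.
split; apply: ler_sum => i _; rewrite rowK linearB /=.
- exact: (fG i _ _).1.
- exact: (fG i _ _).2.
Qed.

Lemma quad_bounds_sum (R : realType) (n d : nat) (mu L : R)
    (f : 'I_n -> 'rV[R]_d -> R) (G : 'I_n -> 'rV[R]_d -> 'rV[R]_d) :
  (forall i, quad_bounds mu L (f i) (G i)) ->
  quad_bounds (n%:R * mu) (n%:R * L) (fun y => \sum_i f i y)
    (fun y => \sum_i G i y).
Proof.
move=> fG x y.
have nE (c : R) : n%:R * c / 2 * normsq (x - y) = \sum_(i < n) c / 2 * normsq (x - y).
  by rewrite sumr_const card_ord -[RHS]mulr_natl !mulrA.
rewrite innerC inner_sumr !nE -!big_split /=.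
split; apply: ler_sum => i _; rewrite innerC.
- exact: (fG i _ _).1.
- exact: (fG i _ _).2.
Qed.

Lemma quad_bounds_monotone (R : realType) (m n : nat) (mu L : R)
    (f : 'M[R]_(m, n) -> R) G x y : quad_bounds mu L f G ->
  mu * normsq (x - y) <= inner (G x - G y) (x - y).
Proof.
move=> fG; have := (fG x y).1; have := (fG y x).1.
rewrite (normsqC y x) -(opprB x y) !innerE; lra.
Qed.

(** Expand |u - mu v|^2 >= 0 for u = G x - G y, v = x - y, and use strong monotonicity. For the
    conjugate, whose gradient inverts [G], this becomes a Lipschitz bound. *)
Lemma quad_bounds_inv_lipschitz (R : realType) (m n : nat) (mu L : R)
    (f : 'M[R]_(m, n) -> R) G x y : 0 < mu -> quad_bounds mu L f G ->
  mu ^+ 2 * normsq (x - y) <= normsq (G x - G y).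
Proof.
move=> mu0 fG; have := quad_bounds_monotone x y fG.
move: (G x - G y) (x - y) => u v uv.
have := normsq_ge0 (u - mu *: v); rewrite /normsq !innerE (innerC v u).
move: uv; rewrite /normsq; move: (inner _ _) (inner _ _) (inner _ _) => a b c.
move=> bc; have := ler_wpM2l (ltW mu0) bc; lra.
Qed.

(** Along a unit matrix v the difference quotient at t lies within |t| K |v|^2 of [inner y v], so it
    is squeezed to that value. *)
Lemma grad_of_sandwich (R : realType) (m n : nat) (F : 'M[R]_(m, n) -> R)
    (z y : 'M[R]_(m, n)) (K : R) :
  (forall z', F z + inner y (z' - z) <= F z'
     <= F z + inner y (z' - z) + K * normsq (z' - z)) ->
  grad F z = y.
Proof.
move=> Fz; apply/matrixP => i j; rewrite mxE.
set v := delta_mx i j.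
have yv : inner y v = y i j.
  rewrite /inner (bigD1 i) //= (bigD1 j) //= big1 => [|k kj].
    rewrite big1 => [|k ki]; first by rewrite mxE !eqxx mulr1 !addr0.
    by apply: big1 => l _; rewrite mxE (negbTE ki) mulr0.
  by rewrite mxE (negbTE kj) andbF mulr0.
have cvgA (A : R) :
    ((y i j + `|t| * A) @[t --> (0 : R)^'] --> y i j)%classic.
  rewrite -[X in (_ --> X)%classic]addr0; apply: cvgD; first exact: cvg_cst.
  have t0 : (`|t| @[t --> (0 : R)^'] --> `|0 : R|)%classic.
    by apply: cvg_norm; exact: nbhs_dnbhs.
  by have := cvgM t0 (cvg_cst A); rewrite normr0 mul0r; apply.
apply: cvg_lim => //; rewrite -yv.
apply: (@squeeze_cvgr _ _ _ _ (fun t : R => y i j + `|t| * (- (K * normsq v)))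
    (fun t : R => y i j + `|t| * (K * normsq v)));
  [|rewrite yv; exact: cvgA|rewrite yv; exact: cvgA].
near=> t; have t0 : t != 0 by near: t; exact: nbhs_dnbhs_neq.
have := Fz (t *: v + z); rewrite addrK innerZr yv /normsq !innerE -/(normsq v).
rewrite /= -[t^-1 *: _]/(t^-1 * _).
set D := (F _ - F z); set N := K * normsq v => /andP[h1 h2].
have KN : K * (t * (t * normsq v)) = t * t * N by rewrite /N; ring.
have {}h1 : t * y i j <= D by rewrite /D; lra.
have {}h2 : D <= t * y i j + t * t * N by rewrite /D; lra.
have N0 : 0 <= N.
  have : 0 < t * t by rewrite -expr2 exprn_even_gt0.
  by move=> /pmulr_rge0 <-; lra.
have ttN : 0 <= t * t * N by rewrite mulr_ge0 // -expr2 sqr_ge0.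
set q := t^-1 * D.
have Dq : D = t * q by rewrite mulrA divff // mul1r.
rewrite {}Dq in h1 h2.
have [tp|tn] : 0 < t \/ t < 0 by case: (ltgtP t 0) t0 => // *; [right|left].
  rewrite (gtr0_norm tp) -(ler_pM2l tp) -[X in _ && X](ler_pM2l tp).
  by apply/andP; split; lra.
rewrite (ltr0_norm tn) -(ler_nM2l tn) -[X in _ && X](ler_nM2l tn).
by apply/andP; split; lra.
Unshelve. all: by end_near. Qed.

Lemma continuous_sumr (R : realType) (T : topologicalType) (I : finType)
    (f : I -> T -> R) :
  (forall i, continuous (f i)) -> continuous (fun x => \sum_i f i x).
Proof.
by move=> cf; apply: continuous_big => [|i _]; [exact: add_continuous|exact: cf].
Qed.

(* Completing the square: [f y - <z, y>] grows quadratically, so a minimizer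
   over a large box is global, and a gradient step from it shows that its
   gradient vanishes. *)
Lemma quad_bounds_gradient_onto (R : realType) (d : nat) (mu L : R)
    (f : 'rV[R]_d -> R) G (z : 'rV[R]_d) :
  0 < mu -> 0 < L -> continuous f -> quad_bounds mu L f G ->
  exists y, G y = z.
Proof.
move=> mu0 L0 cf fG.
pose h y := f y - inner z y.
have [c cE] : exists c, c = G 0 - z by exists (G 0 - z).
have h_ge y : h 0 - normsq c / mu + mu / 4 * normsq y <= h y.
  have := (fG y 0).1; rewrite /h subr0 inner0r.
  have := normsq_ge0 (c + (mu / 2) *: y).
  rewrite [normsq (_ + _)]/normsq !innerE -/(normsq c) -/(normsq y) (innerC y c).
  have -> : inner (G 0) y = inner c y + inner z y by rewrite cE !innerE; lra.
  move=> sq.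
  have : 0 <= mu^-1 * (normsq c + mu * inner c y + mu ^+ 2 / 4 * normsq y).
    by apply: mulr_ge0; [rewrite invr_ge0 ltW|lra].
  have -> : mu^-1 * (normsq c + mu * inner c y + mu ^+ 2 / 4 * normsq y) =
            normsq c / mu + inner c y + mu / 4 * normsq y.
    by field; rewrite gt_eqF.
  lra.
pose B := normsq c / mu.
have B0 : 0 <= B by rewrite divr_ge0 ?normsq_ge0 // ltW.
(* This radius gives mu/4 r^2 >= B, so by [h_ge] the values of [h] outside the box are at least
   [h 0]. *)
pose r := 1 + 4 * B / mu.
have Bmu : 0 <= B / mu by rewrite divr_ge0 // ltW.
have r1 : 1 <= r by rewrite /r; lra.
have rB : B <= mu / 4 * r ^+ 2.
  have -> : B = mu / 4 * (4 * B / mu) by field; rewrite gt_eqF.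
  rewrite ler_pM2l ?divr_gt0 //; apply: (@le_trans _ _ r); first by rewrite /r; lra.
  by rewrite expr2 ler_peMl //; lra.
pose A := [set y : 'rV[R]_d | forall i, `[- r, r]%classic (y ord0 i)]%classic.
have A0 : A 0 by move=> i /=; rewrite mxE in_itv /=; apply/andP; split; lra.
have cA : compact A.
  apply: (@rV_compact _ _ (fun=> `[- r, r]%classic)) => i; exact: segment_compact.
have cz : continuous (fun y : 'rV[R]_d => inner z y).
  apply: (@continuous_sumr _ _ _ (fun i (y : 'rV[R]_d) => \sum_j z i j * y i j)) => i.
  apply: (@continuous_sumr _ _ _ (fun j (y : 'rV[R]_d) => z i j * y i j)) => j y.
  apply: (@continuousM _ _ (fun=> z i j) (fun y : 'rV[R]_d => y i j)).
    exact: cst_continuous.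
  exact: coord_continuous.
have ch : continuous h.
  by move=> y; apply: (@continuousB _ _ _ f (inner z)); [exact: cf|exact: cz].
have [y _ ymin] : exists2 y, y \in A & forall x, x \in A -> h y <= h x.
  apply: compact_EVT_min => //; first by exists 0.
  exact: continuous_subspaceT.
have {}ymin x : h y <= h x.
  have [xA|/existsNP[i /negP xi]] := pselect (A x); first by apply: ymin; rewrite inE.
  have h0 : h y <= h 0 by apply: ymin; rewrite inE.
  have : r ^+ 2 <= normsq x.
    apply: le_trans (sqr_entry_le_normsq x ord0 i).
    rewrite -[leRHS]real_normK ?num_real // lerXn2r ?nnegrE //; first lra.
    by move: xi; rewrite in_itv /= -ler_norml -ltNge => /ltW.
  move=> rx; have : mu / 4 * r ^+ 2 <= mu / 4 * normsq x.
    by rewrite ler_pM2l // divr_gt0.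
  by have := h_ge x; rewrite -/B; lra.
exists y; apply/eqP; rewrite -subr_eq0; apply: contraT => /normsq_gt0.
have [g gE] : exists g, g = G y - z by exists (G y - z).
rewrite -gE => gpos.
have := (fG (y - L^-1 *: g) y).2; have := ymin (y - L^-1 *: g).
rewrite /h (addrC y) addrK /normsq !innerE -/(normsq g).
have -> : inner (G y) g = normsq g + inner z g.
  by rewrite /normsq {2}gE !innerE; lra.
have -> : L / 2 * - - (L^-1 * (L^-1 * normsq g)) = L^-1 / 2 * normsq g.
  by field; rewrite gt_eqF.
have : 0 < L^-1 * normsq g by rewrite mulr_gt0 ?invr_gt0.
lra.
Qed.

(** * Conjugates *)

(* [inner (G x) x - f x] is the value at [G x] of the Fenchel conjugate of f. *)
Lemma quad_bounds_conjugate (R : realType) (m n : nat) (mu L : R)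
    (f : 'M[R]_(m, n) -> R) G x y : 0 < mu -> 0 < L -> quad_bounds mu L f G ->
  inner (G y) y - f y + inner y (G x - G y) + L^-1 / 2 * normsq (G x - G y)
    <= inner (G x) x - f x
  <= inner (G y) y - f y + inner y (G x - G y) + mu^-1 / 2 * normsq (G x - G y).
Proof.
move=> mu0 L0 sb; apply/andP; split.
  (* Lower bound: compare the upper model of f around y with the affine minorant at x, at a common
     point w. This w maximizes the resulting bound <G x - G y, w - y> - L/2 |w - y|^2. *)
  have := (sb (y + L^-1 *: (G x - G y)) y).2.
  have := (sb (y + L^-1 *: (G x - G y)) x).1.
  have : 0 <= mu / 2 * normsq (y + L^-1 *: (G x - G y) - x).
    by rewrite mulr_ge0 ?normsq_ge0 ?divr_ge0 ?ltW.
  have [D DE] : exists D, D = G x - G y by exists (G x - G y).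
  have GxD : inner (G x) D = inner (G y) D + normsq D.
    by rewrite /normsq [X in _ + inner X D]DE innerDl innerNl addrC subrK.
  have LD : L / 2 * normsq (L^-1 *: D) = L^-1 / 2 * normsq D.
    by rewrite /normsq innerZl innerZr; field; rewrite gt_eqF.
  have yD : inner y D = inner (G x) y - inner (G y) y.
    by rewrite innerC DE !innerE.
  have wy : y + L^-1 *: D - y = L^-1 *: D by rewrite addrAC subrr add0r.
  rewrite -DE wy LD => pos.
  rewrite !innerDr innerNr innerZr GxD innerZr yD mulrDr.
  move: pos; move: (normsq _) => u. lra.
(* Upper bound: strong convexity around y, then Young's inequality in the form of the square
   below. *)
have := (sb x y).1.
have : 0 <= mu^-1 * normsq ((G x - G y) - mu *: (x - y)).
  by rewrite mulr_ge0 ?normsq_ge0 ?invr_ge0 ?ltW.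
have -> : mu^-1 * normsq ((G x - G y) - mu *: (x - y)) =
    mu^-1 * normsq (G x - G y) - 2 * inner (G x - G y) (x - y) + mu * normsq (x - y).
  rewrite /normsq; move: (G x - G y) (x - y) => u v.
  by rewrite !innerE (innerC v u); field; rewrite gt_eqF.
move: (normsq _) (normsq _) => u v.
rewrite (innerC y) !innerE; lra.
Qed.

Section conjugate.
Context {R : realType} {n d : nat} (mu L : R) (f : 'I_n -> 'rV[R]_d -> R).
Hypotheses (mu0 : 0 < mu) (L0 : 0 < L)
  (fSC : forall i, smooth_strongly_convex mu L (f i)).

(** The gradient of the stacked function. It is onto and [Fstar] is explicit at its values, so facts
    about [Fstar] at z are proved by writing z as some [stack_grad x]. *)
Let stack_grad (x : 'M[R]_(n, d)) := \matrix_i grad (f i) (row i x).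

Let stack_bounds :
  quad_bounds mu L (fun x : 'M[R]_(n, d) => \sum_i f i (row i x)) stack_grad.
Proof.
by apply: (quad_bounds_stack (G := fun i => grad (f i))) => i; case: (fSC i).
Qed.

(** The tangent of [f i] at [y] lies below [f i], so the supremum is attained at [y]. *)
Lemma fenchel_at_grad i y :
  fenchel (f i) (grad (f i) y) = inner (grad (f i) y) y - f i y.
Proof.
have fb := (fSC i).2.
set S := [set inner (grad (f i) y) x - f i x | x in [set: 'rV[R]_d]]%classic.
have ubS : ubound S (inner (grad (f i) y) y - f i y).
  move=> _ [x _ <-]; have := (fb x y).1.
  have : 0 <= mu / 2 * normsq (x - y) by rewrite mulr_ge0 ?normsq_ge0 ?divr_ge0 ?ltW.
  rewrite !innerE; lra.
apply/eqP; rewrite eq_le; apply/andP; split.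
  by apply: ge_sup ubS; exists (inner (grad (f i) y) y - f i y), y.
by apply: ub_le_sup; [exists (inner (grad (f i) y) y - f i y)|exists y].
Qed.

Lemma stack_grad_onto z : exists x : 'M[R]_(n, d), stack_grad x = z.
Proof.
have /choice[y yE] : forall i, exists y, grad (f i) y = row i z.
  move=> i; have [fdiff fb] := fSC i.
  apply: (@quad_bounds_gradient_onto _ _ mu L (f i)) => // x.
  by apply: differentiable_continuous; exact: fdiff.
by exists (\matrix_i y i); apply/row_matrixP => i; rewrite !rowK.
Qed.

Lemma Fstar_at_grad x : Fstar f (stack_grad x) =
  inner (stack_grad x) x - \sum_i f i (row i x).
Proof.
rewrite /Fstar inner_row -sumrB; apply: eq_bigr => i _.
by rewrite rowK fenchel_at_grad.
Qed.

Lemma Fstar_bounds_at x y :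
  Fstar f (stack_grad y) + inner y (stack_grad x - stack_grad y)
    + L^-1 / 2 * normsq (stack_grad x - stack_grad y) <= Fstar f (stack_grad x)
  <= Fstar f (stack_grad y) + inner y (stack_grad x - stack_grad y)
    + mu^-1 / 2 * normsq (stack_grad x - stack_grad y).
Proof.
by rewrite !Fstar_at_grad; exact: quad_bounds_conjugate stack_bounds.
Qed.

Lemma grad_Fstar_at_grad x : grad (Fstar f) (stack_grad x) = x.
Proof.
apply: (@grad_of_sandwich _ _ _ _ _ _ (mu^-1 / 2)) => z.
have [y <-] := stack_grad_onto z.
have /andP[lb ->] := Fstar_bounds_at y x; rewrite andbT; apply: le_trans lb.
by rewrite lerDl mulr_ge0 ?normsq_ge0 ?divr_ge0 ?invr_ge0 ?ltW.
Qed.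

Lemma Fstar_quad_bounds : quad_bounds L^-1 mu^-1 (Fstar f) (grad (Fstar f)).
Proof.
move=> z w; have [x <-] := stack_grad_onto z; have [y <-] := stack_grad_onto w.
by rewrite grad_Fstar_at_grad; apply/andP; exact: Fstar_bounds_at.
Qed.

Lemma grad_Fstar_lipschitz z w :
  mu ^+ 2 * normsq (grad (Fstar f) z - grad (Fstar f) w) <= normsq (z - w).
Proof.
have [x <-] := stack_grad_onto z; have [y <-] := stack_grad_onto w.
by rewrite !grad_Fstar_at_grad; exact: quad_bounds_inv_lipschitz stack_bounds.
Qed.

(** The gradient of the sum is onto, hence vanishes at some x. The dual point stacks the gradients
    of the [f i] at x: it lies in L^perp precisely because they sum to zero. *)
Lemma unique_minimizer_of_sum : (0 < n)%N -> exists x : 'rV[R]_d,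
  unique_minimizer (fun y => \sum_i f i y) x /\
  exists2 z, in_Lperp z & grad (Fstar f) z = \matrix_(i < n) x.
Proof.
move=> n0; have n0R : 0 < n%:R :> R by rewrite ltr0n.
have sumb := quad_bounds_sum (fun i => (fSC i).2).
have [x xE] : exists x, \sum_i grad (f i) x = 0.
  apply: (quad_bounds_gradient_onto 0 _ _ _ sumb); rewrite ?mulr_gt0 //.
  apply: continuous_sumr => i x.
  by apply: differentiable_continuous; exact: (fSC i).1.
exists x; split.
  move=> y yx; have := (sumb y x).1; rewrite xE innerC inner0r addr0.
  have : 0 < n%:R * mu / 2 * normsq (y - x).
    by rewrite !mulr_gt0 ?invr_gt0 ?normsq_gt0 ?subr_eq0.
  lra.
exists (stack_grad (\matrix_(i < n) x)); last exact: grad_Fstar_at_grad.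
by rewrite /in_Lperp -[RHS]xE; apply: eq_bigr => i _; rewrite !rowK.
Qed.

End conjugate.

(** * Averaging matrices *)

(** For n > 0, the orthogonal projection onto consensus vectors; L^perp is its kernel. *)
Definition avg (R : realType) (n : nat) : 'M[R]_n := const_mx n%:R^-1.

Lemma avg_mul (R : realType) (n d : nat) (x : 'M[R]_(n, d)) i :
  row i (avg R n *m x) = n%:R^-1 *: \sum_j row j x.
Proof.
apply/rowP => k; rewrite !mxE summxE mulr_sumr.
by apply: eq_bigr => j _; rewrite !mxE.
Qed.

Lemma in_LperpP (R : realType) (n d : nat) (x : 'M[R]_(n, d)) :
  (0 < n)%N -> in_Lperp x <-> avg R n *m x = 0.
Proof.
move=> n0; split=> [x0|x0].
  by apply/row_matrixP => i; rewrite avg_mul x0 scaler0 row0.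
have := avg_mul x (Ordinal n0); rewrite x0 row0 => /esym/eqP.
by rewrite scaler_eq0 invr_eq0 pnatr_eq0 eqn0Ngt n0 => /eqP.
Qed.

Lemma avg_idem (R : realType) (n : nat) :
  (0 < n)%N -> avg R n *m avg R n = avg R n.
Proof.
move=> n0; apply/row_matrixP => i; rewrite avg_mul; apply/rowP => j.
rewrite !mxE summxE (eq_bigr (fun=> n%:R^-1)) => [|k _]; last by rewrite !mxE.
by rewrite sumr_const card_ord -[X in _ * X]mulr_natl mulfV ?mulr1 // pnatr_eq0 -lt0n.
Qed.

Lemma tr_avg (R : realType) (n : nat) : (avg R n)^T = avg R n.
Proof. by rewrite /avg trmx_const. Qed.

(* The first two clauses keep the deviation from the mean in L^perp, which makes
   the property stable under products. *)
Definition averaging (R : realType) (n : nat) (c : R) (B : 'M[R]_n) : Prop :=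
  [/\ B *m avg R n = avg R n, avg R n *m B = avg R n
    & forall x : 'cV[R]_n, avg R n *m x = 0 -> normsq (B *m x) <= c * normsq x].

Lemma normsq_col (R : realType) (m n : nat) (x : 'M[R]_(m, n)) :
  normsq x = \sum_j normsq (col j x).
Proof.
rewrite /normsq /inner exchange_big; apply: eq_bigr => j _.
by apply: eq_bigr => i _; rewrite big_ord1 !mxE.
Qed.

(** The squared norm of a stack is the sum over its d columns, and each column contracts
    separately. *)
Lemma averaging_le (R : realType) (n d : nat) (c : R) (B : 'M[R]_n)
    (x : 'M[R]_(n, d)) :
  averaging c B -> avg R n *m x = 0 -> normsq (B *m x) <= c * normsq x.
Proof.
move=> [_ _ Bc] x0; rewrite !normsq_col mulr_sumr; apply: ler_sum => j _.
by rewrite !colE -!mulmxA; apply: Bc; rewrite mulmxA x0 mul0mx.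
Qed.

Lemma averaging_weaken (R : realType) (n : nat) (c c' : R) (B : 'M[R]_n) :
  c <= c' -> averaging c B -> averaging c' B.
Proof.
move=> cc' [BJ JB Bc]; split=> // x /Bc /le_trans; apply.
by rewrite ler_wpM2r // normsq_ge0.
Qed.

Lemma averaging_prod (R : realType) (n : nat) (c : R) (B : nat -> 'M[R]_n)
    (s : seq nat) :
  0 <= c -> (forall q, averaging c (B q)) ->
  averaging (c ^+ size s) (\big[mulmx/1%:M]_(q <- s) B q).
Proof.
move=> c0 Bc; elim: s => [|q s [IHl IHr IHc]] /=.
  by rewrite big_nil; split=> [||x _]; rewrite ?mul1mx ?mulmx1 // expr0 mul1r.
have [BJ JB cB] := Bc q; rewrite big_cons; split=> [||x x0].
- by rewrite -mulmxA IHl BJ.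
- by rewrite mulmxA JB IHr.
rewrite -mulmxA exprS -mulrA.
apply: le_trans (cB _ _) _; first by rewrite mulmxA IHr.
by rewrite ler_wpM2l // IHc.
Qed.

(** The matrix identities are checked by columns: those of [avg] are consensus vectors, and those of
    [W] sum to zero. *)
Lemma gossip_averaging (R : realType) (n : nat) (chi : R) E (W : 'M[R]_n) :
  (0 < n)%N -> gossip_matrix chi E W -> averaging (1 - chi^-1) (1%:M - W).
Proof.
move=> n0 [_ Wker Wrange Wc].
have colJ (x : 'cV[R]_n) : avg R n *m x = 0 <-> \sum_i x i 0 = 0.
  rewrite -in_LperpP // /in_Lperp; split=> [/rowP/(_ 0)|x0].
    by rewrite summxE mxE => x0; rewrite -[RHS]x0; apply: eq_bigr => i _; rewrite mxE.
  apply/rowP => j; rewrite ord1 summxE mxE -[RHS]x0.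
  by apply: eq_bigr => i _; rewrite mxE.
have col_eq0 (A : 'M[R]_n) : (forall j, col j A = 0) -> A = 0.
  by move=> A0; apply/matrixP => i j; have /colP/(_ i) := A0 j; rewrite !mxE.
split=> [||x x0].
- rewrite mulmxBl mul1mx; apply/eqP; rewrite subr_eq addrC -subr_eq subrr eq_sym.
  apply/eqP/col_eq0 => j; rewrite colE -mulmxA -colE.
  by apply: Wker => i k; rewrite !mxE.
- rewrite mulmxBr mulmx1; apply/eqP; rewrite subr_eq addrC -subr_eq subrr eq_sym.
  apply/eqP/col_eq0 => j; rewrite colE -mulmxA; exact/colJ.
- by rewrite mulmxBl mul1mx normsqC; apply: Wc; apply/colJ.
Qed.

(** With T the number of rounds, (1 - 1/chi)^T <= exp(- T/chi) <= exp(- ln 2) = 1/2. *)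
Lemma multi_consensus_averaging (R : realType) (n : nat) (chi : R) E
    (W : nat -> 'M[R]_n) k :
  (0 < n)%N -> gossip_network chi E W ->
  averaging (1 / 2) (1%:M - multi_consensus W (consensus_rounds chi) k).
Proof.
move=> n0 [_ chi1 Wg]; have chi0 : 0 < chi by lra.
have c0 : 0 <= 1 - chi^-1 by rewrite subr_ge0 invf_le1.
rewrite /multi_consensus opprB addrC subrK.
apply: averaging_weaken (averaging_prod _ c0 (fun q => gossip_averaging n0 (Wg q))).
rewrite size_rev size_iota -mulnBl subSnn mul1n.
set T := consensus_rounds chi.
have Tge : chi * ln 2 <= T%:R.
  rewrite /T /consensus_rounds natr_absz ger0_norm ?ceil_ge //.
  by rewrite ceil_ge0 (lt_le_trans _ (mulr_ge0 (ltW chi0) (ln_ge0 _))) // ?ltrN10 ?ler1n.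
apply: (@le_trans _ _ (expR (- chi^-1) ^+ T)).
  by rewrite lerXn2r ?nnegrE ?expR_ge0 // expR_ge1Dx.
rewrite -expRM_natl -[leRHS](@lnK R) ?posrE ?divr_gt0 // ler_expR.
rewrite div1r lnV ?posrE // mulrN lerN2 ler_pdivlMr //; lra.
Qed.

(** * The energy of ADOM *)

(* Here [2 * L * tau] is eta, whose square is L mu / 49.  The lemma is applied to
   a = z + P m - z_opt, b = z_g - z_opt, p = P m and h = P grad Fstar(z_g), with P the
   orthogonal projection onto L^perp. *)
Lemma adom_energy_decrease (R : realType) (n d : nat) (mu L tau Fg Ff Ff' Fs : R)
    (a b p h p' : 'M[R]_(n, d)) :
  0 < tau -> tau <= 14^-1 -> 0 < L -> mu = 196 * L * tau ^+ 2 ->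
  normsq p' <= 1 / 2 * normsq (p - (2 * L * tau) *: h) ->
  Ff' <= Fg - mu / 4 * normsq h ->
  Fs <= Ff ->
  Fg - Fs + L^-1 / 2 * normsq b <= inner h b ->
  tau * inner h (b - a + p) <= (1 - tau) * (Ff - Fg) ->
  normsq (a + tau *: (b - a + p) - (2 * L * tau) *: h) + normsq p'
    + 4 * L * (Ff' - Fs) + 4 / 7 * tau * normsq b
  <= (1 - tau / 14) * (normsq a + normsq p + 4 * L * (Ff - Fs)).
Proof.
move=> tau0 tau14 L0 muE.
have [k kE] : exists k, k = (2 * L * tau) *: h by exists ((2 * L * tau) *: h).
rewrite -kE.
have [u uE] : exists u, u = b - a + p by exists (b - a + p).
have LtL c : 2 * L * tau * (L^-1 / 2 * c) = tau * c by field; rewrite gt_eqF.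
have kk : normsq k = 4 * L ^+ 2 * tau ^+ 2 * normsq h.
  by rewrite /normsq kE innerZl innerZr; ring.
(* The descent step thus pays 49 |k|^2; the terms in k will cost 1 + 1/2 + 1 + 30. *)
have muh : 4 * L * (mu / 4 * normsq h) = 49 * normsq k by rewrite kk muE; field.
move=> p'_le descent FsFf strong conv.
have {descent} : 4 * L * Ff' <= 4 * L * (Fg - mu / 4 * normsq h).
  by rewrite ler_pM2l // mulr_gt0.
rewrite mulrBr muh => descent.
have {strong} : 2 * (2 * L * tau * (Fg - Fs + L^-1 / 2 * normsq b)) <= 2 * inner k b.
  by rewrite kE innerZl ler_pM2l // ler_pM2l // !mulr_gt0.
rewrite [2 * L * tau * _]mulrDr LtL => strong.
have {conv} : 4 * L * (tau * inner h u) <= 4 * L * ((1 - tau) * (Ff - Fg)).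
  by rewrite uE ler_pM2l // mulr_gt0.
have -> : 4 * L * (tau * inner h u) = 2 * inner k u by rewrite kE innerZl; ring.
move=> conv.
have gap : 0 <= L * tau * (Ff - Fs) by rewrite mulr_ge0 ?subr_ge0 // mulr_ge0 // ltW.
(* These squares absorb cross terms: [uk] absorbs -2 tau <u, k>, [pk] absorbs -3 <k, p> (the weight
   20 keeps the share of |p|^2 at 3/40), and [ab] and [ap] absorb those of 2 tau <a, u>. *)
have uk : 0 <= normsq (tau *: u + k) by exact: normsq_ge0.
have pk : 0 <= normsq (p + 20 *: k) by exact: normsq_ge0.
have ab : 0 <= tau * normsq (a - b) by rewrite mulr_ge0 ?normsq_ge0 // ltW.
have ap : 0 <= tau * normsq (a - 2 *: p) by rewrite mulr_ge0 ?normsq_ge0 // ltW.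
(* The three squares and |u|^2 add up to 3 (|a|^2 + |b|^2 + |p|^2). As tau <= 1/14, the term 2 tau^2
   |u|^2 costs at most 3/7 tau times that bracket, leaving exactly -tau/14 |a|^2 and -4/7 tau
   |b|^2. *)
have uu : 0 <= tau ^+ 2 * (normsq (a + b) + normsq (b - p) + normsq (a + p)).
  by rewrite mulr_ge0 ?sqr_ge0 // !addr_ge0 ?normsq_ge0.
have tt : 0 <= tau * (14^-1 - tau) * (normsq a + normsq b + normsq p).
  by rewrite mulr_ge0 ?addr_ge0 ?normsq_ge0 // mulr_ge0 ?subr_ge0 // ltW.
have tp : 0 <= (14^-1 - tau) * normsq p by rewrite mulr_ge0 ?normsq_ge0 ?subr_ge0.
have pp : 0 <= normsq p by exact: normsq_ge0.
have qq : 0 <= normsq k by exact: normsq_ge0.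
have ua : inner u a = inner a b - inner a a + inner a p.
  by rewrite uE !innerE (innerC b) (innerC p).
have uuE : inner u u = inner a a + inner b b + inner p p
    - 2 * inner a b - 2 * inner a p + 2 * inner b p.
  rewrite uE !innerE (innerC b a) (innerC p a) (innerC p b); lra.
(* Since a = b + p - u, <a, k> splits into terms controlled by [strong], [pk] and [conv]. *)
have ak : inner a k = inner k b + inner k p - inner k u.
  rewrite uE !innerE (innerC k a); lra.
rewrite -uE; move: p'_le descent strong conv gap uk pk ab ap uu tt tp pp qq ua uuE ak.
clear LtL kk muh uE kE.
rewrite /normsq !innerE (innerC k a) (innerC k u) (innerC b a) (innerC p a) (innerC p b).
rewrite (innerC a u) (innerC p k).
move: (inner a a) (inner u a) (inner k p) (inner k k) (inner u k) (inner a k) (inner b b)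
  (inner a b) (inner a p) (inner u u) (inner p p) (inner p' p') (inner k b) (inner b p).
clear; move=> aa ua kp kk uk ak bb ab ap uu pp p'p' kb bp.
by move=> *; subst; lra.
Qed.

Section adom.
Context {R : realType} {n d : nat} (mu L : R) (F : 'M[R]_(n, d) -> R).
Variables (G : 'M[R]_(n, d) -> 'M[R]_(n, d)) (zs : 'M[R]_(n, d)) (Ws : nat -> 'M[R]_n).
Hypotheses (n0 : (0 < n)%N) (mu0 : 0 < mu) (muL : mu <= L).
Hypothesis Fb : quad_bounds L^-1 mu^-1 F G.
Hypothesis avgW : forall k, averaging (1 / 2) (1%:M - Ws k).
Hypothesis zs0 : avg R n *m zs = 0.
(** All blocks of [G zs] agree, so it is orthogonal to L^perp: first-order optimality of [zs] on
    L^perp. *)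
Hypothesis Gzs : avg R n *m G zs = G zs.

Let J := avg R n.
Let prm := adom_mc_params mu L.
Let tau := p_tau prm.

(** The orthogonal projection P onto L^perp. *)
Let dev (x : 'M[R]_(n, d)) := x - J *m x.

Lemma inner_dev x v : J *m v = 0 -> inner (dev x) v = inner x v.
Proof.
by move=> v0; rewrite /dev innerDl innerNl inner_mulmxl tr_avg v0 inner0r subr0.
Qed.

Lemma avg_gossip k : J *m Ws k = 0 /\ Ws k *m J = 0.
Proof.
have [BJ JB _] := avgW k; split.
- move: JB; rewrite mulmxBr mulmx1 => /eqP.
  by rewrite subr_eq addrC -subr_eq subrr eq_sym => /eqP.
- move: BJ; rewrite mulmxBl mul1mx => /eqP.
  by rewrite subr_eq addrC -subr_eq subrr eq_sym => /eqP.
Qed.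

Lemma avg_dev x : J *m dev x = 0.
Proof. by rewrite /dev mulmxBr mulmxA avg_idem // subrr. Qed.

Definition adom_energy (s : adom_state R n d) : R :=
  normsq (st_z s + dev (st_m s) - zs) + normsq (dev (st_m s))
    + 4 * L * (F (st_zf s) - F zs).

Definition adom_feasible (s : adom_state R n d) : Prop :=
  J *m st_z s = 0 /\ J *m st_zf s = 0.

(** With s = sqrt(mu/L) the parameters read tau = s/14 and eta = s L/7. *)
Lemma adom_tauE : [/\ 0 < tau, tau <= 14^-1, mu = 196 * L * tau ^+ 2,
  p_eta prm = 2 * L * tau & p_eta prm * p_alpha prm = tau].
Proof.
have L0 := lt_le_trans mu0 muL.
have [s sE] : exists s, s = Num.sqrt (mu / L) by exists (Num.sqrt (mu / L)).
have s0 : 0 < s by rewrite sE sqrtr_gt0 divr_gt0.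
have ss : s ^+ 2 = mu / L by rewrite sE sqr_sqrtr // divr_ge0 // ltW.
have s1 : s <= 1.
  have : s ^+ 2 <= 1 by rewrite ss ler_pdivrMr // mul1r.
  by rewrite expr_le1 // ltW.
have sL : Num.sqrt (mu * L) = s * L.
  have -> : mu * L = (s * L) ^+ 2 by rewrite exprMn ss; field; rewrite gt_eqF.
  by rewrite sqrtr_sqr ger0_norm // mulr_ge0 // ltW.
rewrite /tau /prm /= -sE sL; split; first by lra.
- lra.
- have -> : mu = s ^+ 2 * L by rewrite ss; field; rewrite gt_eqF.
  by field.
- by field.
- by field; rewrite gt_eqF.
Qed.

Lemma adom_step_feasible k s : adom_feasible s ->
  adom_feasible (adom_step prm G (Ws k) s).
Proof.
move=> [z0 zf0]; have [JW _] := avg_gossip k.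
have zg0 : J *m adom_zg prm s = 0.
  by rewrite mulmxDr -!scalemxAr z0 zf0 !scaler0 addr0.
have JWx x : J *m (Ws k *m x) = 0 by rewrite mulmxA JW mul0mx.
rewrite /adom_step /adom_feasible /=; split.
  by rewrite 2!mulmxDr -!scalemxAr JWx mulmxBr z0 zg0 subrr !scaler0 !addr0.
by rewrite mulmxBr -!scalemxAr JWx zg0 scaler0 subr0.
Qed.

Lemma adom_run_feasible z0 m0 k : J *m z0 = 0 ->
  adom_feasible (adom_run prm G Ws z0 m0 k).
Proof. by move=> z00; elim: k => [//|k]; exact: adom_step_feasible. Qed.

(** In the lower bound at [zs] the linear term pairs a consensus vector with an element of L^perp,
    so it vanishes. *)
Lemma adom_gap_ge0 v : J *m v = 0 -> F zs <= F v.
Proof.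
move=> v0; have := (Fb v zs).1.
have -> : inner (G zs) (v - zs) = 0.
  by rewrite -Gzs inner_mulmxl tr_avg mulmxBr v0 zs0 subrr inner0r.
have : 0 <= L^-1 / 2 * normsq (v - zs).
  by rewrite mulr_ge0 ?normsq_ge0 ?divr_ge0 ?invr_ge0 // ltW // (lt_le_trans mu0).
lra.
Qed.

Lemma adom_energy_ge0 s : adom_feasible s -> 0 <= adom_energy s.
Proof.
move=> [_ zf0]; have L0 := lt_le_trans mu0 muL.
apply: addr_ge0; first by rewrite addr_ge0 ?normsq_ge0.
by rewrite mulr_ge0 ?subr_ge0 ?adom_gap_ge0 // mulr_ge0 // ltW.
Qed.

Lemma adom_energy_step k s : adom_feasible s ->
  adom_energy (adom_step prm G (Ws k) s)
    + 4 / 7 * tau * normsq (adom_zg prm s - zs)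
  <= (1 - tau / 14) * adom_energy s.
Proof.
move=> [z0 zf0]; have L0 := lt_le_trans mu0 muL.
have [tau0 tau14 muE etaE alphaE] := adom_tauE.
have [JW WJ] := avg_gossip k.
set zg := adom_zg prm s; set g := G zg.
have zgE : zg = tau *: st_z s + (1 - tau) *: st_zf s by [].
have zg0 : J *m zg = 0 by rewrite zgE mulmxDr -!scalemxAr z0 zf0 !scaler0 addr0.
set r := st_m s - p_eta prm *: g.
have devr : dev r = dev (st_m s) - (2 * L * tau) *: dev g.
  rewrite /r etaE /dev mulmxBr -scalemxAr; move: (J *m st_m s) (J *m g) => A B.
  by apply/matrixP => i j; rewrite !mxE; ring.
have W_dev x : Ws k *m dev x = Ws k *m x by rewrite /dev mulmxBr mulmxA WJ mul0mx subr0.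
have dev_step x : dev (x - 1 *: (Ws k *m x)) = (1%:M - Ws k) *m dev x.
  rewrite mulmxBl mul1mx W_dev scale1r {1}/dev mulmxBr [J *m (Ws k *m x)]mulmxA JW.
  by rewrite mul0mx subr0 addrAC.
have {}dev_step := dev_step r.
(* The gossip term cancels: [st_z] gains [Ws k *m r] and the projected [st_m] loses it, so only the
   exact projection [dev g] remains. *)
have zhatE : st_z s + (p_eta prm * p_alpha prm) *: (zg - st_z s) + 1 *: (Ws k *m r)
    + dev (r - 1 *: (Ws k *m r)) - zs
  = (st_z s + dev (st_m s) - zs) + tau *: (zg - st_z s) - (2 * L * tau) *: dev g.
  rewrite dev_step mulmxBl mul1mx W_dev devr alphaE scale1r.
  move: (Ws k *m r) (dev _) (_ *: _) (tau *: _) => A B C D.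
  by apply/matrixP => i j; rewrite !mxE; ring.
have uE : (zg - zs) - (st_z s + dev (st_m s) - zs) + dev (st_m s) = zg - st_z s.
  by apply/matrixP => i j; rewrite !mxE; ring.
have -> : adom_energy (adom_step prm G (Ws k) s) =
    normsq (st_z s + (p_eta prm * p_alpha prm) *: (zg - st_z s)
            + 1 *: (Ws k *m r) + dev (r - 1 *: (Ws k *m r)) - zs)
    + normsq (dev (r - 1 *: (Ws k *m r)))
    + 4 * L * (F (zg - mu *: (Ws k *m g)) - F zs) by [].
rewrite zhatE -uE /adom_energy.
apply: (@adom_energy_decrease _ _ _ mu _ _ (F zg)) => //.
- by rewrite dev_step -devr; apply: averaging_le => //; exact: avg_dev.
(* The step mu, for a 1/mu-smooth F, decreases F by at least mu/2 (|P g|^2 - |P g - W g|^2), and the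
   contraction makes this at least mu/4 |P g|^2. *)
- have : normsq ((1%:M - Ws k) *m dev g) <= 1 / 2 * normsq (dev g).
    by apply: averaging_le => //; exact: avg_dev.
  rewrite mulmxBl mul1mx W_dev.
  have Wg0 : J *m (Ws k *m g) = 0 by rewrite mulmxA JW mul0mx.
  have := (Fb (zg - mu *: (Ws k *m g)) zg).2.
  have -> : zg - mu *: (Ws k *m g) - zg = - (mu *: (Ws k *m g)).
    by rewrite addrAC subrr add0r.
  rewrite -/g innerNr innerZr -(inner_dev g Wg0).
  have -> : mu^-1 / 2 * normsq (- (mu *: (Ws k *m g))) =
      mu / 2 * normsq (Ws k *m g).
    by rewrite /normsq innerNl innerNr innerZl innerZr; field; rewrite gt_eqF.
  move: (dev g) (Ws k *m g) (F _) (F _) => u v F1 F2.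
  rewrite /normsq !innerE (innerC v u).
  move: (inner u u) (inner u v) (inner v v) => x y z F12 xyz.
  have : mu / 2 * (x - y + (- y - - z)) <= mu / 2 * (1 / 2 * x).
    by rewrite ler_pM2l // divr_gt0.
  lra.
- exact: adom_gap_ge0.
- rewrite inner_dev; last by rewrite mulmxBr zg0 zs0 subrr.
  have := (Fb zs zg).1; rewrite normsqC -(opprB zg) innerNr -/g; lra.
- rewrite uE inner_dev; last by rewrite mulmxBr zg0 z0 subrr.
  (* Convexity of F between z_g and z_f; the definition of z_g turns (1 - tau)(z_f - z_g) into tau
     (z_g - z). *)
  have : (1 - tau) * (F zg + inner g (st_zf s - zg)) <= (1 - tau) * F (st_zf s).
    rewrite ler_wpM2l //; first by lra.
    apply: le_trans (Fb (st_zf s) zg).1.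
    by rewrite lerDl mulr_ge0 ?normsq_ge0 ?divr_ge0 ?invr_ge0 // ltW.
  have -> : (1 - tau) * (F zg + inner g (st_zf s - zg)) =
      (1 - tau) * F zg + inner g ((1 - tau) *: (st_zf s - zg)).
    by rewrite mulrDr innerZr.
  have -> : (1 - tau) *: (st_zf s - zg) = tau *: (zg - st_z s).
    by rewrite zgE; apply/matrixP => i j; rewrite !mxE; ring.
  rewrite innerZr; lra.
Qed.

Lemma adom_energy_run z0 m0 k : J *m z0 = 0 ->
  adom_energy (adom_run prm G Ws z0 m0 k)
  <= (1 - tau / 14) ^+ k * adom_energy (AdomState z0 z0 m0).
Proof.
move=> z00; have [tau0 tau14 _ _ _] := adom_tauE.
elim: k => [|k IH]; first by rewrite expr0 mul1r.
have := adom_energy_step k (adom_run_feasible m0 k z00).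
have : 0 <= 4 / 7 * tau * normsq (adom_zg prm (adom_run prm G Ws z0 m0 k) - zs).
  by rewrite !mulr_ge0 ?normsq_ge0 // ltW.
have : (1 - tau / 14) * adom_energy (adom_run prm G Ws z0 m0 k) <=
    (1 - tau / 14) * ((1 - tau / 14) ^+ k * adom_energy (AdomState z0 z0 m0)).
  by rewrite ler_wpM2l //; lra.
rewrite mulrA -exprS /=; lra.
Qed.

(** The surplus of one energy step is at most the energy before it, since the energy after it is
    nonnegative. *)
Lemma adom_zg_linear z0 m0 k : J *m z0 = 0 ->
  4 / 7 * tau * normsq (adom_zg prm (adom_run prm G Ws z0 m0 k) - zs)
  <= expR (- (tau / 14)) ^+ k * adom_energy (AdomState z0 z0 m0).
Proof.
move=> z00; have [tau0 tau14 _ _ _] := adom_tauE.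
have fk := adom_run_feasible m0 k z00.
have := adom_energy_step k fk; have := adom_energy_run m0 k z00.
have := adom_energy_ge0 (adom_step_feasible k fk); have e0 := adom_energy_ge0 fk.
have E0 : 0 <= adom_energy (AdomState z0 z0 m0) by apply: adom_energy_ge0.
have : (1 - tau / 14) ^+ k * adom_energy (AdomState z0 z0 m0) <=
    expR (- (tau / 14)) ^+ k * adom_energy (AdomState z0 z0 m0).
  by rewrite ler_wpM2r // lerXn2r ?nnegrE ?expR_ge0 ?expR_ge1Dx //; lra.
have : 0 <= tau / 14 * adom_energy (adom_run prm G Ws z0 m0 k).
  by rewrite mulr_ge0 // divr_ge0 // ltW.
lra.
Qed.

End adom.

(** * Convergence of the outputs and the round count *)

Lemma avg_stack_const (R : realType) (n d : nat) (x : 'rV[R]_d) :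
  (0 < n)%N -> avg R n *m (\matrix_(i < n) x) = \matrix_(i < n) x.
Proof.
move=> n0; apply/row_matrixP => i; rewrite avg_mul rowK.
rewrite (eq_bigr (fun=> x)) => [|j _]; last by rewrite rowK.
rewrite sumr_const card_ord -[x *+ n]scaler_nat scalerA mulVf ?scale1r //.
by rewrite pnatr_eq0 -lt0n.
Qed.

Lemma adom_mc_linear (R : realType) (n d : nat) (mu L chi : R)
    (f : 'I_n -> 'rV[R]_d -> R) E W (z0 m0 : 'M[R]_(n, d)) :
  (0 < n)%N -> 0 < mu -> mu <= L ->
  (forall i, smooth_strongly_convex mu L (f i)) ->
  gossip_network chi E W -> in_Lperp z0 ->
  exists2 C0 : R, 1 <= C0 & exists x : 'rV[R]_d,
    unique_minimizer (fun y => \sum_i f i y) x /\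
    forall k, normsq (adom_mc_output mu L chi f W z0 m0 k - \matrix_(i < n) x)
      <= C0 * expR (- (p_tau (adom_mc_params mu L) / 14)) ^+ k.
Proof.
move=> n0 mu0 muL fSC net /(in_LperpP _ n0) z00.
have L0 := lt_le_trans mu0 muL.
have [x [xmin [zs /(in_LperpP _ n0) zs0 Gzs]]] := unique_minimizer_of_sum mu0 L0 fSC n0.
have Gavg : avg R n *m grad (Fstar f) zs = grad (Fstar f) zs.
  by rewrite Gzs avg_stack_const.
have Fb := Fstar_quad_bounds mu0 L0 fSC.
have avgW k := multi_consensus_averaging k n0 net.
have conv k := adom_zg_linear n0 mu0 muL Fb avgW zs0 Gavg m0 k z00.
have [tau0 _ _ _ _] := adom_tauE mu0 muL.
have E0 : 0 <= adom_energy L (Fstar f) zs (AdomState z0 z0 m0).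
  exact: (adom_energy_ge0 mu0 muL Fb zs0 Gavg).
set prm := adom_mc_params mu L in conv tau0 *.
move: (adom_energy _ _ _ _) E0 conv => e e0 conv.
have t0 : 0 < 4 / 7 * p_tau prm by lra.
(* Combines the surplus factor 4/7 tau with the Lipschitz constant 1/mu of grad Fstar. *)
pose c : R := (4 / 7 * p_tau prm * mu ^+ 2)^-1.
have c0 : 0 < c by rewrite /c invr_gt0 mulr_gt0 ?exprn_gt0.
exists (c * e + 1); first by rewrite lerDr mulr_ge0 // ltW.
exists x; split=> // k.
apply: (@le_trans _ _ (c * e * expR (- (p_tau prm / 14)) ^+ k)); last first.
  by rewrite ler_wpM2r ?exprn_ge0 ?expR_ge0 // lerDl.
rewrite -Gzs -mulrA -ler_pdivrMl // invrK (mulrC e).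
apply: le_trans (conv k); rewrite -(mulrA (_ * _) (mu ^+ 2)).
by rewrite ler_pM2l //; exact: (grad_Fstar_lipschitz mu0 L0 fSC).
Qed.

(** Here ln 2 <= 1, and rounding up adds at most 1 <= chi. *)
Lemma consensus_rounds_le (R : realType) (chi : R) :
  1 <= chi -> (consensus_rounds chi)%:R <= 2 * chi.
Proof.
move=> chi1; have ln2 : 0 <= chi * ln 2 by rewrite mulr_ge0 ?ln_ge0 ?ler1n //; lra.
have ln21 : ln 2 <= 1 :> R by have := @le_ln1Dx R 1; rewrite -[1 + 1]/2; apply; lra.
rewrite /consensus_rounds natr_absz ger0_norm ?ceil_ge0 ?(lt_le_trans _ ln2) ?ltrN10 //.
have /andP[+ _] := ceil_itv (chi * ln 2); rewrite intrB.
have : chi * ln 2 <= chi * 1 by rewrite ler_wpM2l //; lra.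
lra.
Qed.

Theorem theorem5 (R : realType) :
  exists C : R, 0 < C /\
  forall (n d : nat) (mu L chi : R) (f : 'I_n -> 'rV[R]_d -> R)
         (E : nat -> {set 'I_n * 'I_n}) (W : nat -> 'M[R]_n)
         (z0 m0 : 'M[R]_(n, d)),
    (0 < n)%N ->
    0 < mu -> mu <= L ->
    (forall i, smooth_strongly_convex mu L (f i)) ->
    gossip_network chi E W ->
    in_Lperp z0 ->
    exists eps0 : R, 0 < eps0 /\
    forall eps : R, 0 < eps -> eps < eps0 ->
    exists k : nat,
      [/\ eps_accurate f eps (adom_mc_output mu L chi f W z0 m0 k),
          (adom_mc_local_rounds k)%:R <= C * (Num.sqrt (L / mu) * ln (1 / eps))
        & (adom_mc_comm_rounds chi k)%:R
            <= C * (chi * Num.sqrt (L / mu) * ln (1 / eps))].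
Proof.
(* At most 394 S l iterations are run, each with at most 2 chi communication rounds, and 2 * 394 <=
   800. *)
exists 800; split=> [|n d mu L chi f E W z0 m0 n0 mu0 muL fSC net z00]; first by rewrite ltr0n.
have L0 := lt_le_trans mu0 muL.
have [C0 C01 [x [xmin conv]]] := adom_mc_linear m0 n0 mu0 muL fSC net z00.
have C00 : 0 < C0 by lra.
have [tau0 _ _ _ _] := adom_tauE mu0 muL.
(* Below this threshold C0 eps <= 1, and C0 >= 1 gives ln(1/eps) >= 1, which absorbs additive
   constants. *)
exists (expR (- 1) / C0); split=> [|eps eps_gt0]; first by rewrite divr_gt0 ?expR_gt0.
rewrite ltr_pdivlMr // => epsC0.
have e1 : expR (- 1) <= 1 :> R by rewrite -expR0 ler_expR.
pose l : R := ln (1 / eps).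
have epsE : eps = expR (- l) by rewrite /l div1r lnV // opprK lnK.
have l1 : 1 <= l.
  rewrite -lerN2 -ler_expR -epsE; apply: le_trans (ltW epsC0).
  by rewrite ler_peMr // ltW.
set S := Num.sqrt (L / mu).
have S1 : 1 <= S by rewrite -sqrtr1 ler_wsqrtr // ler_pdivlMr // mul1r.
set tau := p_tau (adom_mc_params mu L) in conv tau0.
have tauS : tau * S = 14^-1.
  have inv : Num.sqrt (mu / L) * S = 1.
    rewrite /S -sqrtrM ?divr_ge0 ?ltW //.
    have -> : mu / L * (L / mu) = 1 by field; rewrite !gt_eqF.
    exact: sqrtr1.
  by rewrite /tau /= -(mulrA (1 / (7 * 2))) inv; field.
have Sl : 1 <= S * l by rewrite mulr_ege1.
have pos : 0 <= 392 * (S * l) by lra.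
(* The rate tau/14 is 1/(196 S), so 392 S l iterations bring the decay factor down to eps^2. One eps
   absorbs the problem-dependent [C0], which keeps the final constant universal. *)
pose k := `|Num.ceil (392 * (S * l))|%N.
have kE : k%:R = (Num.ceil (392 * (S * l)))%:~R :> R.
  by rewrite natr_absz ger0_norm // ceil_ge0 (lt_le_trans _ pos) ?ltrN10.
have kge : 392 * (S * l) <= k%:R by rewrite kE ceil_ge.
have kle : k%:R <= 392 * (S * l) + 1.
  by rewrite kE; have /andP[+ _] := ceil_itv (392 * (S * l)); rewrite intrB; lra.
(* One unit comes from the ceiling and one from counting iteration 0; both are at most S l. *)
have rounds : k.+1%:R <= 394 * (S * l) by rewrite -natr1; lra.
exists k; split.
- exists x; split=> //; apply: le_trans (conv k) _.
  have : expR (- (tau / 14)) ^+ k <= eps * eps.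
    rewrite -expRM_natl epsE -expRD ler_expR.
    have : tau / 14 * (392 * (S * l)) <= tau / 14 * k%:R by rewrite ler_pM2l ?divr_gt0.
    have -> : tau / 14 * (392 * (S * l)) = 2 * l.
      have -> : tau / 14 * (392 * (S * l)) = 28 * (tau * S) * l by field.
      by rewrite tauS; field.
    lra.
  move=> /(ler_wpM2l (ltW C00)) /le_trans; apply.
  by rewrite mulrA ler_piMl ?ltW // mulrC; lra.
- by apply: le_trans rounds _; rewrite ler_wpM2r //; lra.
- have chi1 := network_chi_ge1 net.
  rewrite /adom_mc_comm_rounds natrM.
  apply: (@le_trans _ _ (394 * (S * l) * (2 * chi))).
    by apply: ler_pM => //; exact: consensus_rounds_le.
  have : 0 <= chi * S * l by rewrite -mulrA mulr_ge0 //; lra.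
  rewrite -/l; lra.
Qed.
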